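(* Let $\phi\ge 1$ and let $\mathcal{I}$ be any $\phi$-smooth instance of scheduling on unrestricted related machines. Then \[ \mathbb{E}_{I\sim\mathcal{I}}\left[\max_{\sigma\in \mathrm{Jump}(I)}\frac{C_{\max}(I,\sigma)}{C^*_{\max}(I)}\right] < 5.1\,\phi+2.5 . \]
   Context: Scheduling on unrestricted related machines: there are machines $M=\{1,\dots,m\}$ with speeds $s_1\ge\dots\ge s_m=1$ and jobs $J=\{1,\dots,n\}$ with processing requirements $p_j\ge 0$; processing job $j$ on machine $i$ takes time $p_j/s_i$. A schedule $\sigma$ assigns every job to a machine; $J_i(\sigma)$ is the set of jobs assigned to machine $i$, the load of $i$ is $L_i(\sigma)=\sum_{j\in J_i(\sigma)}p_j/s_i$, and the makespan is $C_{\max}(I,\sigma)=\max_i L_i(\sigma)$. $C^*_{\max}(I)$ denotes the minimum makespan over all schedules. A machine $i$ is critical if $L_i(\sigma)=C_{\max}(I,\sigma)$. A schedule $\sigma$ is jump optimal if for every critical machine $i$, every job $j\in J_i(\sigma)$ and every machine $i'\neq i$ we have $L_{i'}(\sigma)+p_j/s_{i'}\ge L_i(\sigma)$; $\mathrm{Jump}(I)$ is the set of jump optimal schedules of instance $I$. A $\phi$-smooth instance $\mathcal{I}$ ($\phi\ge1$) is specified by: the number $m$ of machines, speeds $s_1\ge\dots\ge s_m=1$, the number $n$ of jobs, and for each job $j$ a probability density $f_j:[0,1]\to[0,\phi]$; the processing requirements $p_j$ are drawn independently, $p_j$ according to $f_j$. $I\sim\mathcal{I}$ denotes the random instance so obtained,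 and the expectation is over this randomness. *)

(* Defs.v *)
From mathcomp Require Import all_boot all_order all_algebra.
From mathcomp Require Import all_classical all_reals all_analysis.

Set Implicit Arguments.
Unset Strict Implicit.
Unset Printing Implicit Defensive.

Import Order.TTheory GRing.Theory Num.Theory.
Import numFieldNormedType.Exports.

Local Open Scope classical_set_scope.
Local Open Scope ring_scope.

Section Scheduling.
Variables (R : realType) (m n : nat).

(* The machine set is nonempty, hence the index type 'I_m.+1: there are m.+1
   machines and n jobs, both numbered from 0. *)
Definition schedule := {ffun 'I_n -> 'I_m.+1}.

Definition valid_speeds (s : 'I_m.+1 -> R) : Prop :=
  (forall i i' : 'I_m.+1, (i <= i')%N -> s i' <= s i) /\ s ord_max = 1.

Variables (s : 'I_m.+1 -> R) (p : 'I_n -> R).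

Definition jobs_on (sigma : schedule) (i : 'I_m.+1) : {set 'I_n} :=
  [set j | sigma j == i]%SET.

Definition load (sigma : schedule) (i : 'I_m.+1) : R :=
  \sum_(j in jobs_on sigma i) p j / s i.

Definition Cmax (sigma : schedule) : R :=
  \big[Num.max/load sigma ord0]_(i < m.+1) load sigma i.

(* The constant schedule only serves as the start value of the minimum. *)
Definition Copt : R :=
  \big[Num.min/Cmax [ffun=> ord0]]_(sigma : schedule) Cmax sigma.

Definition critical (sigma : schedule) (i : 'I_m.+1) : bool :=
  load sigma i == Cmax sigma.

Definition jump_optimal (sigma : schedule) : bool :=
  [forall i, critical sigma i ==>
    [forall j in jobs_on sigma i, forall i', (i' != i) ==>
      (load sigma i <= load sigma i' + p j / s i')]].

Definition Jump : {set schedule} := [set sigma | jump_optimal sigma]%SET.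

End Scheduling.

Definition smooth_density (R : realType) (phi : R) (f : R -> R) : Prop :=
  [/\ measurable_fun (`[0, 1] : set R) f,
      (forall x, 0 <= x <= 1 -> 0 <= f x <= phi) &
      (\int[lebesgue_measure]_(x in `[0%R, 1%R]) (f x)%:E = 1)%E].

(* The density is f restricted to [0, 1]; X lies in [0, 1] almost surely. *)
Definition has_density01 (d : measure_display) (T : measurableType d)
    (R : realType) (P : probability T R) (X : {RV P >-> R}) (f : R -> R) :
    Prop :=
  forall A : set R, measurable A ->
    (distribution P X A =
     \int[lebesgue_measure]_(x in A `&` `[0%R, 1%R]) (f x)%:E)%E.

Definition mutually_independent (d : measure_display) (T : measurableType d)
    (R : realType) (P : probability T R) (I : finType)
    (X : I -> {RV P >-> R}) : Prop :=
  forall (K : {set I}) (A : I -> set R),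
    (forall i, i \in K -> measurable (A i)) ->
    (P (\bigcap_(i in [set` K]) (X i @^-1` A i)) =
     \prod_(i in K) P (X i @^-1` A i))%E.

(* Main.v *)
(* Let W be the total work and let tau be any schedule, with A the machines it
   uses, so |A| <= n and W <= Cmax(tau) * s(A). Summing over A the inequalities
   saying that a job, of size at most b, on a critical machine of a jump optimal
   sigma has no reason to move gives Cmax(sigma) * s(A) <= W + n b. Hence the
   ratio is at most 1 + n b / W: at most 1 + n (b = W), and at most 1 + n / W
   (b = 1).

   For n >= 2 put M_j := max(p_j, p_(j+1)), indices cyclic. As 2 W >= sum M_j,
   the arithmetic-harmonic mean inequality gives n / W <= (2 / n) sum_j 1 / M_j.
   By independence P(M_j <= t) <= (phi t)^2, and covering 1 / M_j by layers at
   the levels phi (3/2)^k, k < K, gives an expectation of at most (5/2) phi for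
   the part M_j > (3/2)^-K / phi. On the remaining event, of probability at most
   n (3/2)^(-2K), the ratio is at most 1 + n. Taking n <= (3/2)^K, the total is
   at most 5 phi + 2. *)

Require Import Defs.
From mathcomp Require Import all_boot all_order all_algebra.
From mathcomp Require Import all_classical all_reals all_analysis.
From mathcomp Require Import measurable_realfun ring lra.

Set Implicit Arguments.
Unset Strict Implicit.
Unset Printing Implicit Defensive.

Import Order.TTheory GRing.Theory Num.Theory.
Import numFieldNormedType.Exports.
Local Open Scope classical_set_scope.
Local Open Scope ring_scope.

(** * Worst-case bounds for jump optimal schedules *)

Section Deterministic.
Context {R : realType} {m n : nat}.
Variables (s : 'I_m.+1 -> R) (p : 'I_n -> R).
Hypotheses (s_gt0 : forall i, 0 < s i) (p_ge0 : forall j, 0 <= p j).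

Lemma speed_mul_load (sigma : schedule m n) i :
  s i * load s p sigma i = \sum_(j | sigma j == i) p j.
Proof.
rewrite /load mulr_sumr; apply: eq_big => [j|j _]; first by rewrite inE.
by rewrite mulrC divfK ?gt_eqF.
Qed.

Lemma sum_speed_mul_load (sigma : schedule m n) :
  \sum_i s i * load s p sigma i = \sum_j p j.
Proof.
under eq_bigr do rewrite speed_mul_load.
by rewrite [RHS](partition_big sigma xpredT).
Qed.

Lemma load_ge0 (sigma : schedule m n) i : 0 <= load s p sigma i.
Proof. by apply: sumr_ge0 => j _; rewrite divr_ge0 // ltW. Qed.

Lemma load_le_Cmax (sigma : schedule m n) i :
  load s p sigma i <= Cmax s p sigma.
Proof. exact: le_bigmax. Qed.

Lemma Cmax_ge0 (sigma : schedule m n) : 0 <= Cmax s p sigma.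
Proof. exact: le_trans (load_ge0 _ ord0) (load_le_Cmax _ _). Qed.

Lemma exists_critical (sigma : schedule m n) :
  exists i, load s p sigma i = Cmax s p sigma.
Proof.
rewrite /Cmax; elim/big_ind: _ => [|x y [i <-] [j <-]|i _]; last by exists i.
  by exists ord0.
by case: leP => _; [exists j|exists i].
Qed.

Lemma total_le_Cmax (tau : schedule m n) :
  \sum_j p j <= Cmax s p tau * \sum_(i in tau @: 'I_n) s i.
Proof.
rewrite -(sum_speed_mul_load tau) mulr_sumr.
rewrite (bigID (mem (tau @: 'I_n))) /= [X in _ + X]big1 ?addr0; last first.
  move=> i iA; rewrite speed_mul_load big_pred0 // => j.
  by apply: contraNF iA => /eqP <-; apply: imset_f.
by apply: ler_sum => i _; rewrite mulrC ler_wpM2r ?load_le_Cmax // ltW.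
Qed.

(** A job on a critical machine gains nothing by moving to [i], so [Cmax] is at most the load of [i]
    plus [b / s i]. Multiply by [s i] and sum over [A], which is left free so that it can later be
    the set of machines used by a competing schedule. *)
Lemma jump_optimal_Cmax (sigma : schedule m n) (b : R) (A : {set 'I_m.+1}) :
  jump_optimal s p sigma -> 0 <= b -> (forall j, p j <= b) ->
  Cmax s p sigma * \sum_(i in A) s i <= \sum_j p j + b *+ #|A|.
Proof.
move=> opt b0 pb; have [i0 crit] := exists_critical sigma.
have W0 : 0 <= \sum_j p j by apply: sumr_ge0.
have [j ji0|no_job] := pickP (fun j => sigma j == i0); last first.
  rewrite -crit /load big_pred0 ?mul0r; first by rewrite addr_ge0 ?mulrn_wge0.
  by move=> j; rewrite inE no_job.
rewrite -(sum_speed_mul_load sigma) -sumr_const mulr_sumr.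
apply: (@le_trans _ _ (\sum_(i in A) (s i * load s p sigma i + b))); last first.
  rewrite big_split /= lerD2r [leRHS](bigID (mem A)) /= lerDl sumr_ge0 // => i _.
  by rewrite mulr_ge0 ?load_ge0 // ltW.
apply: ler_sum => i _; rewrite -crit.
(* Jump optimality says nothing about the critical machine itself; there [0 <= b] suffices. *)
have [->|ii0] := eqVneq i i0; first by rewrite mulrC lerDl.
move: opt => /forallP /(_ i0) /implyP; rewrite /critical crit eqxx => /(_ isT).
move=> /forallP /(_ j); rewrite inE ji0 /= => /forallP /(_ i).
rewrite ii0 /= => step.
rewrite mulrC -[b](divfK (lt0r_neq0 (s_gt0 i))) [b / _ * _]mulrC -mulrDr.
rewrite ler_pM2l // (le_trans step) // lerD2l.
by rewrite ler_pM2r ?invr_gt0.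
Qed.

(* Comparing on the machines used by tau removes their total speed, which is
   at least total / Cmax tau. *)
Lemma Cmax_jump_optimal_le (sigma tau : schedule m n) (b : R) :
  jump_optimal s p sigma -> 0 <= b -> (forall j, p j <= b) ->
  Cmax s p sigma * \sum_j p j <= Cmax s p tau * (\sum_j p j + b *+ n).
Proof.
move=> opt b0 pb; have Wle := total_le_Cmax tau.
apply: le_trans (ler_wpM2l (Cmax_ge0 sigma) Wle) _.
rewrite mulrCA ler_wpM2l ?Cmax_ge0 //.
apply: le_trans (jump_optimal_Cmax _ opt b0 pb) _; rewrite lerD2l.
apply: ler_wpMn2l => //.
by rewrite (leq_trans (leq_imset_card _ _)) // card_ord.
Qed.

Lemma jump_ratio_le (sigma : schedule m n) (b : R) :
  jump_optimal s p sigma -> 0 <= b -> (forall j, p j <= b) ->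
  Cmax s p sigma / Copt s p <= 1 + n%:R * b / \sum_j p j.
Proof.
move=> opt b0 pb; set W := \sum_j p j.
have W0 : 0 <= W by apply: sumr_ge0.
have [C0|Cn0] := eqVneq (Cmax s p sigma) 0.
  by rewrite C0 mul0r addr_ge0 // divr_ge0 // mulr_ge0.
have C0 : 0 < Cmax s p sigma by rewrite lt_def Cn0 Cmax_ge0.
have {}W0 : 0 < W.
  have [i crit] := exists_critical sigma.
  apply: (@lt_le_trans _ _ (s i * load s p sigma i)).
    by rewrite mulr_gt0 // crit.
  rewrite /W -(sum_speed_mul_load sigma) (bigD1 i) //= lerDl.
  by apply: sumr_ge0 => k _; rewrite mulr_ge0 ?load_ge0 // ltW.
have Wb : 0 < W + b *+ n by rewrite ltr_wpDr // mulrn_wge0.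
have Wb' : 0 < Cmax s p sigma * W / (W + b *+ n) by rewrite divr_gt0 ?mulr_gt0.
(* The comparison holds for every [tau], hence for the minimum. The left side is positive, so [Copt]
   is too and may be divided by. *)
have key : Cmax s p sigma * W / (W + b *+ n) <= Copt s p.
  by apply: le_bigmin => [|tau _]; rewrite ler_pdivrMr //;
    apply: Cmax_jump_optimal_le.
rewrite ler_pdivrMr ?(lt_le_trans Wb') //.
have -> : 1 + n%:R * b / W = (W + b *+ n) / W.
  by rewrite mulrDl divff ?gt_eqF // mulr_natl.
apply: le_trans (ler_wpM2l _ key); last by rewrite divr_ge0 // ltW.
by rewrite mulrC mulrA divfK ?gt_eqF // mulfK ?gt_eqF.
Qed.

Lemma jump_ratio_le_size (sigma : schedule m n) :
  jump_optimal s p sigma -> Cmax s p sigma / Copt s p <= 1 + n%:R.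
Proof.
move=> opt; have W0 : 0 <= \sum_j p j by apply: sumr_ge0.
apply: le_trans (jump_ratio_le opt W0 _) _.
  by move=> j; rewrite (bigD1 j) //= lerDl sumr_ge0.
rewrite lerD2l -mulrA ler_piMr //.
by have [->|Wn0] := eqVneq (\sum_j p j) 0; rewrite ?mul0r // divff.
Qed.

End Deterministic.

(** * The harmonic mean inequality and geometric layers *)

Section RealInequalities.
Context {R : realType}.

(** The graph of [1 / x] lies above its tangent at the mean [1 / c] of the [M i]; the tangent values
    are summed. *)
Lemma sum_inv_ge (I : finType) (M : I -> R) : (forall i, 0 < M i) ->
  #|I|%:R ^+ 2 / \sum_i M i <= \sum_i (M i)^-1.
Proof.
move=> M0; set Z := \sum_i M i; pose c := #|I|%:R / Z.
have [Z0|Zn0] := eqVneq Z 0.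
  by rewrite Z0 invr0 mulr0 sumr_ge0 // => i _; rewrite invr_ge0 ltW.
(* (1 - c M)^2 >= 0 *)
have tangent i : c *+ 2 - c ^+ 2 * M i <= (M i)^-1.
  have Mn0 : M i != 0 by rewrite gt_eqF.
  rewrite -subr_ge0.
  have -> : (M i)^-1 - (c *+ 2 - c ^+ 2 * M i) = (1 - c * M i) ^+ 2 / M i.
    by field.
  by rewrite divr_ge0 ?sqr_ge0 // ltW.
have le_sum : \sum_i (c *+ 2 - c ^+ 2 * M i) <= \sum_i (M i)^-1.
  by apply: ler_sum => i _; apply: tangent.
apply: le_trans le_sum; rewrite sumrB -mulr_sumr -/Z sumr_const.
rewrite /c le_eqVlt; apply/orP; left; apply/eqP.
rewrite -[_ *+ #|_|]mulr_natl.
by field.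
Qed.

(** Induction on [K]: if [x] exceeds the threshold of level [K], the new indicator vanishes;
    otherwise all indicators equal 1 and the weights telescope to [q ^+ K.+1 - 1]. *)
Lemma inv_le_layers (q c x : R) (K : nat) :
  1 <= q -> 0 < c -> (c * q ^+ K)^-1 < x ->
  x^-1 <= c * (1 + \sum_(k < K)
    (q ^+ k.+1 - q ^+ k) * (x <= (c * q ^+ k)^-1)%R%:R).
Proof.
move=> q1 c0; have q0 : 0 < q by apply: lt_le_trans q1.
have cq k : 0 < c * q ^+ k by rewrite mulr_gt0 // exprn_gt0.
have inv_lt k : (c * q ^+ k)^-1 < x -> x^-1 <= c * q ^+ k.
  move=> h; rewrite -[leRHS]invrK lef_pV2 ?ltW // posrE ?invr_gt0 //.
  by apply: lt_trans h; rewrite invr_gt0.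
elim: K => [|K IH] xK; first by rewrite big_ord0 addr0 -(expr0 q) inv_lt.
rewrite big_ord_recr /=.
have [xle|xgt] := leP x (c * q ^+ K)^-1; last first.
  by rewrite mulr0 addr0 IH.
rewrite mulr1; apply: le_trans (inv_lt _ xK) _; rewrite ler_pM2l //.
rewrite [X in 1 + (X + _)](_ : _ = q ^+ K - 1).
  by rewrite le_eqVlt; apply/orP; left; apply/eqP; ring.
rewrite -[1](expr0 q) -(telescope_sumr _ (leq0n K)) big_mkord.
apply: eq_bigr => k _; rewrite (_ : x <= _ = true) ?mulr1 //.
apply: le_trans xle _; rewrite lef_pV2 ?posrE // ler_pM2l //.
by rewrite ler_weXn2l // ltnW.
Qed.

(** Each term is [(q - 1) / q ^+ k], a geometric series. The squared denominator will come from two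
    independent jobs being small, and keeps the sum below [q] for every [K]. *)
Lemma sum_layer_weights (q : R) (K : nat) : 0 < q ->
  \sum_(k < K) (q ^+ k.+1 - q ^+ k) / (q ^+ k) ^+ 2 = q - q / q ^+ K.
Proof.
move=> q0; elim: K => [|K IH]; first by rewrite big_ord0 expr0 divr1 subrr.
have qn0 : q != 0 by rewrite gt_eqF.
have qKn0 : q ^+ K != 0 by rewrite expf_neq0.
rewrite big_ord_recr IH /= exprS; field.
by rewrite qn0 qKn0.
Qed.

End RealInequalities.

(** * Cyclic pairs of jobs and the layered bound *)

Lemma ordS_neq n (i : 'I_n) : (1 < n)%N -> ordS i != i.
Proof.
move=> n1; apply/eqP => /(congr1 val) /=.
have [lt|ge] := ltnP i.+1 n.
  by rewrite modn_small // => /eqP; rewrite -[X in _ == X]addn0 -addn1 eqn_add2l.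
have -> : i.+1 = n by apply/eqP; rewrite eqn_leq ge andbT.
by rewrite modnn => i0; move: ge; rewrite -i0 leqNgt n1.
Qed.

(** The event [M_j <= t], kept as a conjunction so that its probability factors. *)
Definition pair_below (R : realType) (n : nat) (p : 'I_n -> R) (t : R)
    (j : 'I_n) : bool :=
  (p j <= t) && (p (ordS j) <= t).

Lemma jump_ratio_le_layers (R : realType) (m n : nat) (s : 'I_m.+1 -> R)
    (p : 'I_n -> R) (sigma : schedule m n) (q c : R) (K : nat) :
  (forall i, 0 < s i) -> (forall j, 0 <= p j <= 1) -> 1 <= q -> 0 < c ->
  jump_optimal s p sigma ->
  Cmax s p sigma / Copt s p <= 1 + 2 * c +
    \sum_j (\sum_(k < K) (2 * c / n%:R * (q ^+ k.+1 - q ^+ k)) *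
              (pair_below p (c * q ^+ k)^-1 j)%:R
            + n%:R * (pair_below p (c * q ^+ K)^-1 j)%:R).
Proof.
move=> s0 p01 q1 c0 opt; pose low k j := pair_below p (c * q ^+ k)^-1 j.
have p0 j : 0 <= p j by case/andP: (p01 j).
have p1 j : p j <= 1 by case/andP: (p01 j).
have layer0 k : 0 <= 2 * c / n%:R * (q ^+ k.+1 - q ^+ k).
  by rewrite mulr_ge0 ?divr_ge0 ?mulr_ge0 ?(ltW c0) // subr_ge0 ler_weXn2l.
have c20 : 0 <= 2 * c by rewrite mulr_ge0 // ltW.
(* If some pair lies below the last threshold, its term of weight [n] alone covers the bound
   [1 + n]. *)
have [j lowj|high] := pickP (low K).
  apply: le_trans (jump_ratio_le_size s0 p0 opt) _.
  rewrite -addrA lerD2l (bigD1 j) //= [pair_below _ _ j]lowj mulr1.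
  have slack (x y z t : R) : 0 <= x -> 0 <= y -> 0 <= t -> z <= x + (y + z + t).
    by lra.
  apply: slack => //; apply: sumr_ge0 => i _; first by rewrite mulr_ge0.
  by rewrite addr_ge0 ?mulr_ge0 // sumr_ge0 // => k _; rewrite mulr_ge0.
under eq_bigr => j _ do rewrite [pair_below p (c * q ^+ K)^-1 j]high mulr0 addr0.
apply: le_trans (jump_ratio_le s0 p0 opt ler01 p1) _; rewrite -addrA lerD2l mulr1.
pose M j := Num.max (p j) (p (ordS j)).
have lowE k j : low k j = (M j <= (c * q ^+ k)^-1) by rewrite /low /pair_below ge_max.
have M0 j : (c * q ^+ K)^-1 < M j by rewrite ltNge -lowE high.
have Mgt0 j : 0 < M j.
  apply: lt_trans (M0 j).
  by rewrite invr_gt0 mulr_gt0 // exprn_gt0 // (lt_le_trans ltr01).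
have [n0|n_gt0] := posnP n.
  by rewrite [X in X%:R / _]n0 mul0r addr_ge0 // sumr_ge0 // => j _;
    rewrite sumr_ge0 // => k _; rewrite mulr_ge0.
have nR0 : 0 < n%:R :> R by rewrite ltr0n.
have sumM : 0 < \sum_j M j.
  by rewrite (bigD1 (Ordinal n_gt0)) //= ltr_pwDl // sumr_ge0 // => j _; rewrite ltW.
(* Each job lies in two cyclic pairs, and a maximum is at most the sum. *)
have sumM2 : \sum_j M j <= 2 * \sum_j p j.
  have shift : \sum_j p j = \sum_j p (ordS j).
    by rewrite (reindex_inj (can_inj (@ordSK n))).
  rewrite mulr_natl mulr2n {2}shift -big_split /=; apply: ler_sum => j _.
  by rewrite ge_max lerDl lerDr !p0.
have sump : 0 < \sum_j p j by rewrite -(pmulr_rgt0 _ (ltr0n R 2)) (lt_le_trans sumM).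
apply: (@le_trans _ _ (2 / n%:R * (n%:R ^+ 2 / \sum_j M j))).
  rewrite [leRHS](_ : _ = n%:R * (2 / \sum_j M j)); last first.
    by field; rewrite !gt_eqF.
  rewrite ler_pM2l // ler_pdivlMr // mulrC ler_pdivrMr //.
have -> : 2 * c + \sum_j \sum_(k < K) 2 * c / n%:R * (q ^+ k.+1 - q ^+ k) *
      (pair_below p (c * q ^+ k)^-1 j)%:R =
    2 / n%:R * \sum_j c * (1 + \sum_(k < K) (q ^+ k.+1 - q ^+ k) *
      (M j <= (c * q ^+ k)^-1)%R%:R).
  rewrite -mulr_sumr big_split /= sumr_const card_ord !mulrDr; congr (_ + _).
    by field; rewrite gt_eqF.
  rewrite !mulr_sumr; apply: eq_bigr => j _.
  rewrite !mulr_sumr; apply: eq_bigr => k _.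
  by rewrite [pair_below _ _ _]lowE; ring.
rewrite ler_pM2l ?divr_gt0 //.
have := sum_inv_ge Mgt0; rewrite card_ord => /le_trans; apply.
by apply: ler_sum => j _; apply: inv_le_layers.
Qed.

(** * Expectations of layered bounds, densities and independence *)

Section Probability.
Context {R : realType} {d : measure_display} {T : measurableType d}.
Variable P : probability T R.
Import HBNNSimple.

(* F need not be measurable: it suffices to compare G with the simple functions
   below F. *)
Lemma ae_le_expectation (F G : T -> R) :
  (forall w, 0 <= F w) -> (forall w, 0 <= G w) -> measurable_fun setT G ->
  {ae P, forall w, F w <= G w} -> ('E_P[F] <= 'E_P[G])%E.
Proof.
move=> F0 G0 mG FG; rewrite unlock ge0_integralTE; last first.
  by move=> w; rewrite lee_fin.
apply: ge_ereal_sup => _ [h hF <-]; rewrite -integralT_nnsfun.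
apply: ae_ge0_le_integral => //.
- by move=> w _; rewrite lee_fin.
- exact/measurable_EFinP.
- by move=> w _; rewrite lee_fin.
- exact/measurable_EFinP.
apply: filterS FG => w FGw _; rewrite lee_fin.
by apply: le_trans FGw; rewrite -lee_fin.
Qed.

Lemma expectation_le_layers (I : finType) (F : T -> R) (a : R) (c : I -> R)
    (E : I -> set T) :
  (forall w, 0 <= F w) -> 0 <= a -> (forall i, 0 <= c i) ->
  (forall i, measurable (E i)) ->
  {ae P, forall w, F w <= a + \sum_i c i * \1_(E i) w} ->
  ('E_P[F] <= a%:E + \sum_i (c i)%:E * P (E i))%E.
Proof.
move=> F0 a0 c0 mE FE.
have mI i : measurable_fun setT (\1_(E i) : T -> R).
  by apply: measurable_indic.
have mcI i : measurable_fun setT (fun w => c i * \1_(E i) w).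
  by apply: measurable_funM.
apply: le_trans (ae_le_expectation F0 _ _ FE) _.
- by move=> w; rewrite addr_ge0 // sumr_ge0 // => i _; rewrite mulr_ge0.
- by apply: measurable_funD => //; apply: measurable_sum.
rewrite unlock.
under eq_integral do rewrite EFinD -sumEFin.
rewrite ge0_integralD //; last 2 first.
- by move=> w _; rewrite sume_ge0 // => i _; rewrite lee_fin mulr_ge0.
- by apply: emeasurable_sum => i; apply/measurable_EFinP.
have -> : (\int[P]__ a%:E = a%:E)%E.
  by have := expectation_cst P a; rewrite unlock.
apply: leeD2l.
rewrite ge0_integral_sum //; last 2 first.
- by move=> i; apply/measurable_EFinP.
- by move=> i w _; rewrite lee_fin mulr_ge0.
apply: lee_sum => i _; under eq_integral do rewrite EFinM.
rewrite ge0_integralZl_EFin //; last exact/measurable_EFinP.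
by rewrite integral_indic // setIT.
Qed.

(** The density is at most [phi], and its domain of integration lies in [[0, t]]. *)
Lemma prob_le_density (X : {RV P >-> R}) (f : R -> R) (phi t : R) :
  smooth_density phi f -> has_density01 X f -> 0 <= phi -> 0 <= t ->
  (P (X @^-1` `]-oo, t]) <= (phi * t)%:E)%E.
Proof.
move=> [mf fphi _] Xf phi0 t0.
have -> : P (X @^-1` `]-oo, t]) = distribution P X `]-oo, t] by [].
rewrite Xf //; set D := _ `&` _.
have mD : measurable D by apply: measurableI.
have D01 : D `<=` `[0, 1] by move=> x [].
apply: (@le_trans _ _ (\int[lebesgue_measure]_(x in D) cst phi%:E x)%E).
  apply: ge0_le_integral => //.
  - by move=> x /D01; rewrite /= in_itv /= => /fphi; rewrite lee_fin => /andP[].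
  - by apply/measurable_EFinP; apply: measurable_funS mf.
  - by move=> x /D01; rewrite /= in_itv /= => /fphi; rewrite lee_fin => /andP[].
rewrite integral_cst // EFinM lee_wpmul2l ?lee_fin //.
apply: (@le_trans _ _ (lebesgue_measure (`[0%R, t] : set R))).
  apply: le_measure; rewrite ?inE //.
  by move=> x []; rewrite /= !in_itv /= => xt /andP[x0 _]; rewrite x0 xt.
rewrite lebesgue_measure_itv /= lte_fin; case: ifP => _ //.
by rewrite oppr0 adde0.
Qed.

Lemma ae_density01 (X : {RV P >-> R}) (f : R -> R) :
  has_density01 X f -> {ae P, forall w, 0 <= X w <= 1}.
Proof.
move=> Xf; exists (X @^-1` (~` `[0, 1])); split.
- by rewrite -[X in measurable X]setTI; apply: measurable_funPT => //;
  apply: measurableC.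
- have -> : P (X @^-1` (~` `[0, 1])) = distribution P X (~` `[0, 1]) by [].
  rewrite Xf; last exact: measurableC.
  by rewrite setICl integral_set0.
- by move=> w /=; rewrite in_itv.
Qed.

Lemma mutually_independent2 (I : finType) (X : I -> {RV P >-> R})
    (i j : I) (A : set R) :
  mutually_independent X -> i != j -> measurable A ->
  P (X i @^-1` A `&` X j @^-1` A) = (P (X i @^-1` A) * P (X j @^-1` A))%E.
Proof.
move=> indep ij mA.
have := indep [set i; j]%SET (fun=> A) (fun _ _ => mA).
rewrite big_setU1 ?inE //= big_set1 => <-; congr (P _).
apply/seteqP; split => [w [Xi Xj] k|w h] /=.
  by rewrite !inE => /orP[] /eqP ->.
by split; apply: h; rewrite /= !inE eqxx ?orbT.
Qed.

End Probability.

Theorem theorem2 (R : realType) (phi : R) (hphi : 1 <= phi)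
    (m n : nat) (s : 'I_m.+1 -> R) (hs : valid_speeds s)
    (f : 'I_n -> R -> R) (hf : forall j, smooth_density phi (f j))
    (d : measure_display) (T : measurableType d) (P : probability T R)
    (p : 'I_n -> {RV P >-> R})
    (hp : forall j, has_density01 (p j) (f j))
    (hindep : mutually_independent p) :
  ('E_P[fun w : T =>
          let pw : 'I_n -> R := fun j => p j w in
          (\big[Num.max/0]_(sigma in Jump s pw)
             (Cmax s pw sigma / Copt s pw))%R]
   < (51 / 10 * phi + 5 / 2)%:E)%E.
Proof.
cbv zeta; set F := fun w : T => _.
have phi0 : 0 < phi by apply: lt_le_trans hphi.
have s0 i : 0 < s i.
  by case: hs => mono s1; rewrite (lt_le_trans ltr01) // -s1 mono // leq_ord.
have F0 w : 0 <= F w by apply: bigmax_ge_id.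
have p01 : {ae P, forall w, forall j, 0 <= p j w <= 1}.
  by apply: filter_forall => j; apply: ae_density01 (hp j).
(* With at most one job there are no two distinct neighbours, but the ratio is at most
   [1 + n <= 2]. *)
have [n_le1|n_gt1] := leqP n 1.
  apply: (@le_lt_trans _ _ ('E_P[cst 2%R])%E); last first.
    by rewrite expectation_cst lte_fin; lra.
  apply: ae_le_expectation => //.
  apply: filterS p01 => w pw01; apply: bigmax_le => // sigma.
  rewrite inE => opt; have p0 j : 0 <= p j w by case/andP: (pw01 j).
  apply: le_trans (jump_ratio_le_size s0 p0 opt) _.
  by rewrite (_ : 2 = 1 + 1) // lerD2l lern1.
have nR0 : 0 < n%:R :> R by rewrite ltr0n ltnW.
(* As [q ^+ 2 = 9 / 4 >= 2], this [K] gives [q ^+ K >= 2 ^+ n >= n]. *)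
pose q : R := 3 / 2; pose K := (2 * n)%N.
have q1 : 1 <= q by rewrite /q; lra.
have q0 : 0 < q by apply: lt_le_trans q1.
(* Index [K] stands for the exceptional event of weight [n], so layers and exception form one sum
   over ['I_K.+1]. *)
pose c k := if (k < K)%N then 2 * phi / n%:R * (q ^+ k.+1 - q ^+ k) else n%:R.
have c0 k : 0 <= c k.
  rewrite /c; case: ifP => // _.
  by rewrite mulr_ge0 ?divr_ge0 ?mulr_ge0 ?(ltW phi0) // subr_ge0 ler_weXn2l.
pose low (x : 'I_n * 'I_K.+1) : set T :=
  p x.1 @^-1` `]-oo, (phi * q ^+ x.2)^-1] `&`
  p (ordS x.1) @^-1` `]-oo, (phi * q ^+ x.2)^-1].
have mpre j (t : R) : measurable (p j @^-1` `]-oo, t]).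
  by rewrite -[X in measurable X]setTI; apply: measurable_funPT.
have mlow x : measurable (low x) by apply: measurableI.
have Plow x : (P (low x) <= (((q ^+ x.2) ^+ 2)^-1)%:E)%E.
  have t0 : 0 <= (phi * q ^+ x.2)^-1 by rewrite invr_ge0 mulr_ge0 ?exprn_ge0 // ltW.
  have Pj j : (P (p j @^-1` `]-oo, (phi * q ^+ x.2)^-1%R]) <= ((q ^+ x.2)^-1)%:E)%E.
    apply: le_trans (prob_le_density (hf j) (hp j) (ltW phi0) t0) _.
    by rewrite lee_fin invfM mulrA divff ?gt_eqF // mul1r.
  (* Since [1 < n], the two jobs of a pair are distinct, and independence squares the bound
     [1 / q ^+ k]. *)
  rewrite /low mutually_independent2 // 1?eq_sym ?ordS_neq //.
  by rewrite (expr2 (q ^+ x.2)) (invfM (q ^+ x.2)) EFinM lee_pmul.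
have Fle : {ae P, forall w,
    F w <= 1 + 2 * phi +
    \sum_(x : 'I_n * 'I_K.+1) c x.2 * \1_(low x) w}.
  apply: filterS p01 => w pw01; apply: bigmax_le => [|sigma].
    rewrite addr_ge0 ?addr_ge0 ?mulr_ge0 ?(ltW phi0) //.
    by rewrite sumr_ge0 // => x _; rewrite mulr_ge0.
  rewrite inE => opt; apply: le_trans (jump_ratio_le_layers K s0 pw01 q1 phi0 opt) _.
  have lowE j (k : 'I_K.+1) : \1_(low (j, k)) w =
      (pair_below (fun j => p j w) (phi * q ^+ k)^-1 j)%:R :> R.
    rewrite indicE /pair_below /low /=; congr ((_ : bool)%:R).
    by apply/idP/idP; rewrite inE /= !in_itv /= => /andP.
  rewrite lerD2l -(pair_bigA _ (fun j (k : 'I_K.+1) => c k * \1_(low (j, k)) w)) /=.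
  apply: ler_sum => j _; rewrite big_ord_recr /= lowE {2}/c ltnn lerD2r.
  by apply: ler_sum => k _; rewrite lowE /c /= ltn_ord.
apply: le_lt_trans (expectation_le_layers F0 _ (fun x : 'I_n * 'I_K.+1 => c0 x.2) mlow Fle) _.
  by rewrite addr_ge0 // mulr_ge0 // ltW.
apply: (@le_lt_trans _ _ (1 + 2 * phi + \sum_(x : 'I_n * 'I_K.+1)
    c x.2 / (q ^+ x.2) ^+ 2)%R%:E).
  rewrite [X in (_ <= X)%E](EFinD (1 + 2 * phi)) -sumEFin.
  apply: leeD2l; apply: lee_sum => x _; rewrite EFinM.
  by apply: lee_wpmul2l; [rewrite lee_fin | apply: Plow].
rewrite lte_fin -(pair_bigA _ (fun _ (k : 'I_K.+1) => c k / (q ^+ k) ^+ 2)) /=.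
rewrite sumr_const card_ord big_ord_recr /= {2}/c ltnn.
rewrite (eq_bigr (fun k : 'I_K => 2 * phi / n%:R *
    ((q ^+ k.+1 - q ^+ k) / (q ^+ k) ^+ 2))); last first.
  by move=> k _; rewrite /c ltn_ord mulrA.
rewrite -mulr_sumr sum_layer_weights // -[X in _ + X < _]mulr_natl mulrDr.
have n_le : n%:R <= q ^+ K.
  apply: (@le_trans _ _ (2 ^+ n)); first by rewrite -natrX ler_nat ltnW // ltn_expl.
  by rewrite /K exprM lerXn2r ?nnegrE ?exprn_ge0 ?(ltW q0) // /q; lra.
have qK0 : 0 < q ^+ K by rewrite exprn_gt0.
(* One factor [n] counts the pairs, the other is the weight of the exceptional event. *)
have tail : n%:R * (n%:R / (q ^+ K) ^+ 2) <= 1.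
  by rewrite mulrA ler_pdivrMr ?exprn_gt0 // mul1r -expr2 lerXn2r ?nnegrE // ltW.
have -> : n%:R * (2 * phi / n%:R * (q - q / q ^+ K)) = 2 * phi * (q - q / q ^+ K).
  by field; rewrite !gt_eqF.
(* Here [2 * q = 3]; with the base term [2 * phi] this makes [5 * phi]. *)
have layers : 2 * phi * (q - q / q ^+ K) <= 3 * phi.
  apply: (@le_trans _ _ (2 * phi * q)); last by rewrite /q; lra.
  by rewrite ler_pM2l ?mulr_gt0 // gerBl divr_ge0 // ltW.
apply: (@le_lt_trans _ _ (1 + 2 * phi + (3 * phi + 1))); last by lra.
by rewrite lerD2l lerD.
Qed.
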